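(* Let $n$ be a natural number (positive integer). There is a one-to-one correspondence between the odd factors of $n$ and the decompositions of $n$. More precisely, for each odd (positive) factor $k$ of $n$: (a) if $k < \sqrt{2n}$, then the sequence of consecutive integers $$\frac{n}{k}-\frac{k-1}{2},\quad \frac{n}{k}-\frac{k-1}{2}+1,\quad \ldots,\quad \frac{n}{k}+\frac{k-1}{2}$$ is an odd decomposition of $n$ of length $k$; (b) if $k > \sqrt{2n}$, then the sequence of consecutive integers $$\frac{k-1}{2}-\frac{n}{k}+1,\quad \frac{k-1}{2}-\frac{n}{k}+2,\quad \ldots,\quad \frac{n}{k}+\frac{k-1}{2}$$ is an even decomposition of $n$ of length $2n/k$. Moreover, these are all the decompositions of $n$. The one-to-one correspondence is the map sending each odd factor $k$ of $n$ to the decomposition of $n$ given in (a) or (b).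
   Context: Natural numbers are positive integers, and factors are positive divisors. A decomposition of a natural number $n$ is a (finite, nonempty) sequence of consecutive natural numbers, listed in increasing order, whose sum is $n$. The number of terms is called the length of the decomposition; a decomposition of length $1$ (namely the sequence $(n)$) is allowed. A decomposition is called odd (respectively even) if its length is odd (respectively even). *)

(* Defs.v *)
From mathcomp Require Import all_boot all_order all_algebra.

Set Implicit Arguments.
Unset Strict Implicit.
Unset Printing Implicit Defensive.

Import Order.TTheory GRing.Theory Num.Theory.
Local Open Scope ring_scope.

(* Sequences have entries in [int], so that no truncated subtraction can hide *)
(* a nonpositive term; [is_decomposition] requires the terms to be positive.  *)
Definition is_decomposition (n : nat) (s : seq int) : bool :=
  [&& s != [::],
      all (fun x => 0 < x) s,
      sorted (fun x y => y == x + 1) s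
    & \sum_(x <- s) x == n%:Z].

Definition odd_decomposition (n : nat) (s : seq int) : bool :=
  is_decomposition n s && odd (size s).

Definition even_decomposition (n : nat) (s : seq int) : bool :=
  is_decomposition n s && ~~ odd (size s).

Definition odd_factor (n k : nat) : bool := odd k && (k %| n)%N.

(* The integers a, a + 1, ..., b in this order (empty if b < a). *)
Definition int_range (a b : int) : seq int :=
  if a <= b then [seq a + i%:Z | i <- iota 0 `|b - a|%N.+1] else [::].

(* For an odd factor k of n, the two natural-number divisions below are exact. *)
Definition small_factor_seq (n k : nat) : seq int :=
  int_range ((n %/ k)%N%:Z - (k.-1 %/ 2)%N%:Z)
            ((n %/ k)%N%:Z + (k.-1 %/ 2)%N%:Z).

Definition large_factor_seq (n k : nat) : seq int :=
  int_range ((k.-1 %/ 2)%N%:Z - (n %/ k)%N%:Z + 1)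
            ((n %/ k)%N%:Z + (k.-1 %/ 2)%N%:Z).

(* The value [::] when k = sqrt (2 n) is a dummy; it is not a decomposition,  *)
(* so a claim that this map sends odd factors to decompositions entails that  *)
(* k = sqrt (2 n) does not occur.                                             *)
Definition factor_decomposition (R : rcfType) (n k : nat) : seq int :=
  if (k%:R : R) < Num.sqrt (2 * n%:R) then small_factor_seq n k
  else if Num.sqrt (2 * n%:R) < (k%:R : R) then large_factor_seq n k
  else [::].

(* Main.v *)
Require Import Defs.
From mathcomp Require Import all_boot all_order all_algebra.
From mathcomp Require Import zify.

Set Implicit Arguments.
Unset Strict Implicit.
Unset Printing Implicit Defensive.

Import Order.TTheory GRing.Theory Num.Theory.
Local Open Scope ring_scope.

(** A decomposition of [n] with first term [a] and length [m] is a solution of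
    [m * (2 * a + m - 1) = 2 * n] with [a, m > 0]: this is the arithmetic
    progression sum, doubled ([decomposition_run]).  The two factors on the left
    have opposite parities, and [m] is the smaller one since [a > 0].  Hence
    exactly one of them is odd; call it [k].  It divides [n], and it is [m] or
    the cofactor according as [k ^ 2 < 2 * n] or [k ^ 2 > 2 * n].  Conversely an
    odd factor [k] of [n] yields the factorization [k * (2 * n / k)] of
    [2 * n] into factors of opposite parities, the smaller of which is taken
    as the length.

    Everything is computed in the coordinates [k = 2 * j + 1] and
    [n = q * k] ([odd_factorP]).  There both divisions in the definition of the
    sequences are exact, the two sequences are runs of lengths [2 * j + 1] and
    [2 * q], and the comparison of [k] with the square root of [2 * n] becomes
    that of [2 * j + 1] with [2 * q], i.e. of [j] with [q]; equality is impossible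
    by parity.  The inverse of the correspondence reads [k] off the length of the
    decomposition ([factor_of]). *)

(** * Runs of consecutive integers *)

Definition run (a : int) (m : nat) : seq int := mkseq (fun i => a + i%:Z) m.

Lemma size_run a m : size (run a m) = m.
Proof. exact: size_mkseq. Qed.

Lemma runS a m : run a m.+1 = a :: run (a + 1) m.
Proof.
rewrite /run /mkseq /= addr0 -[1%N]addn0 iotaDl -map_comp; congr (_ :: _).
by apply: eq_map => i /=; lia.
Qed.

Lemma sorted_run a m : sorted (fun x y : int => y == x + 1) (run a m).
Proof.
elim: m a => [//|[//|m] IHm] a; have := IHm (a + 1).
by rewrite (runS a) runS /= eqxx.
Qed.

Lemma sorted_eq_run (x : int) s :
  sorted (fun x y : int => y == x + 1) (x :: s) -> x :: s = run x (size s).+1.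
Proof.
elim: s x => [|y s IHs] x; first by rewrite runS.
by case/andP=> /eqP-> /IHs eq_s; rewrite runS -eq_s.
Qed.

Lemma all_gt0_run a m : all (fun x => 0 < x) (run a m.+1) = (0 < a).
Proof.
apply/allP/idP=> [-> // | a_gt0 _ /mapP[i _ ->]]; last by lia.
by rewrite runS mem_head.
Qed.

(** The sum is doubled to avoid a division by [2], and the length is written as a
    successor because decompositions are nonempty. *)
Lemma sum_run a m : 2 * (\sum_(x <- run a m.+1) x) = m.+1%:Z * (2 * a + m%:Z).
Proof.
elim: m a => [|m IHm] a; first by rewrite runS big_seq1; lia.
by rewrite runS big_cons mulrDr IHm; nia.
Qed.

Lemma decomposition_run n a m :
  is_decomposition n (run a m.+1) =
    (0 < a) && (m.+1%:Z * (2 * a + m%:Z) == 2 * n%:Z).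
Proof.
by rewrite /is_decomposition all_gt0_run sorted_run -sum_run (inj_eq (mulfI _)).
Qed.

Lemma decomposition_is_run n s : is_decomposition n s ->
  exists a m, [/\ s = run a m.+1, 0 < a & m.+1%:Z * (2 * a + m%:Z) = 2 * n%:Z].
Proof.
move=> s_dec; have /and4P[+ _ + _] := s_dec; case: s s_dec => // x s s_dec _.
move=> /sorted_eq_run eq_s; exists x, (size s); split=> //.
all: by move: s_dec; rewrite eq_s decomposition_run => /andP[? /eqP].
Qed.

(** * Odd factors in coordinates *)

Lemma odd_factorP n k :
  reflect (exists q j, n = (q * j.*2.+1)%N /\ k = j.*2.+1) (odd_factor n k).
Proof.
apply: (iffP andP) => [[k_odd /dvdnP[q ->]] | [q [j [-> ->]]]].
  by exists q, k./2; rewrite -{1 3}(odd_double_half k) k_odd.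
by rewrite /= odd_double dvdn_mull.
Qed.

Section Coordinates.

Variables q j : nat.
Let k := j.*2.+1.
Let n := (q * k)%N.

Lemma small_factor_seqE : small_factor_seq n k = run (q%:Z - j%:Z) k.
Proof.
rewrite /small_factor_seq /int_range mulnK // [k.-1]/= -muln2 mulnK //.
rewrite ifT; last by lia.
by rewrite /run /mkseq; congr [seq _ | i <- iota 0 _]; rewrite /k; lia.
Qed.

Lemma large_factor_seqE :
  (0 < q)%N -> large_factor_seq n k = run (j%:Z - q%:Z + 1) q.*2.
Proof.
move=> q_gt0; rewrite /large_factor_seq /int_range mulnK // [k.-1]/=.
rewrite -muln2 mulnK // ifT; last by lia.
by rewrite /run /mkseq; congr [seq _ | i <- iota 0 _]; lia.
Qed.

(** Since [2 * n = k * (2 * q)], comparing [k] with the square root of [2 * n]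
    amounts to comparing [k] with [2 * q]. *)
Lemma lt_sqrtr_factor (R : rcfType) :
  ((k%:R : R) < Num.sqrt (2 * n%:R)) = (j < q)%N.
Proof.
rewrite ltNge -[k%:R]ger0_norm // -sqrtr_sqr ler_sqrt ?exprn_ge0 //.
rewrite -natrX -natrM ler_nat -ltnNge mulnA mul2n ltn_pmul2r //.
by rewrite ltn_Sdouble.
Qed.

(** [2 * q < 2 * j + 1] means [q <= j], so this is the negation of the previous
    comparison: an odd [k] cannot equal [2 * q]. *)
Lemma gt_sqrtr_factor (R : rcfType) :
  (Num.sqrt (2 * n%:R) < (k%:R : R)) = (q <= j)%N.
Proof.
rewrite -[k%:R]ger0_norm // -sqrtr_sqr ltr_sqrt ?exprn_gt0 ?ltr0n //.
by rewrite -natrX -natrM ltr_nat mulnA mul2n ltn_pmul2r // ltnS leq_double.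
Qed.

Lemma small_factor_decomposition :
  (j < q)%N -> is_decomposition n (small_factor_seq n k).
Proof.
move=> lt_jq; rewrite small_factor_seqE decomposition_run.
by apply/andP; split; [lia | apply/eqP; rewrite /n /k; nia].
Qed.

Lemma large_factor_decomposition :
  (0 < q <= j)%N -> is_decomposition n (large_factor_seq n k).
Proof.
case/andP=> q_gt0 le_qj; rewrite large_factor_seqE //.
rewrite -[q.*2]prednK ?double_gt0 // decomposition_run.
by apply/andP; split; [lia | apply/eqP; rewrite /n /k; nia].
Qed.

End Coordinates.

(** The odd one among the length of a decomposition of [n] and its cofactor in
    [2 * n]. *)
Definition factor_of (n : nat) (s : seq int) : nat :=
  if odd (size s) then size s else (2 * n %/ size s)%N.

(** With first term [a] and length [m + 1], the odd one among [m + 1] and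
    [2 * a + m] serves as [k]. *)
Lemma decomposition_has_factor (R : rcfType) n s : is_decomposition n s ->
  exists2 k : nat, odd_factor n k &
    ((k%:R : R) < Num.sqrt (2 * n%:R) /\ s = small_factor_seq n k)
    \/ (Num.sqrt (2 * n%:R) < (k%:R : R) /\ s = large_factor_seq n k).
Proof.
case/decomposition_is_run=> -[] a [m [-> a_gt0 sum_s]] //.
have [m_odd | m_even] := boolP (odd m).
  (* Even length [2 * q] : the cofactor is [2 * a + 2 * q - 1]. *)
  have [q def_m] : exists q, m.+1 = q.*2 by exists m.+1./2; lia.
  have [j def_j] : exists j, j.+1 = (a + q)%N by exists (a + q).-1; lia.
  have -> : n = (q * j.*2.+1)%N by nia.
  exists j.*2.+1; first by apply/odd_factorP; exists q, j.
  right; rewrite gt_sqrtr_factor large_factor_seqE; last by lia.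
  by split; [lia | rewrite def_m; congr run; lia].
(* Odd length [2 * j + 1] : the middle term is [a + j]. *)
have [j def_m] : exists j, m = j.*2 by exists m./2; lia.
rewrite def_m in sum_s *.
have -> : n = ((a + j) * j.*2.+1)%N by nia.
exists j.*2.+1; first by apply/odd_factorP; exists (a + j)%N, j.
left; rewrite lt_sqrtr_factor small_factor_seqE.
by split; [lia | congr run; lia].
Qed.

(** * The correspondence *)

Section Correspondence.

Variables (R : rcfType) (n : nat).
Hypothesis n_gt0 : (0 < n)%N.

Lemma small_factor k : odd_factor n k -> (k%:R : R) < Num.sqrt (2 * n%:R) ->
  is_decomposition n (small_factor_seq n k) /\ size (small_factor_seq n k) = k.
Proof.
case/odd_factorP=> q [j [-> ->]]; rewrite lt_sqrtr_factor => lt_jq.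
by rewrite small_factor_decomposition // small_factor_seqE size_run.
Qed.

Lemma large_factor k : odd_factor n k -> Num.sqrt (2 * n%:R) < (k%:R : R) ->
  [/\ is_decomposition n (large_factor_seq n k),
      ~~ odd (size (large_factor_seq n k)),
      size (large_factor_seq n k) = (2 * n %/ k)%N
    & (2 * n %/ size (large_factor_seq n k))%N = k].
Proof.
case/odd_factorP=> q [j [def_n ->]]; move: n_gt0; rewrite def_n.
rewrite muln_gt0 andbT gt_sqrtr_factor => q_gt0 le_qj.
rewrite large_factor_decomposition ?q_gt0 // large_factor_seqE // size_run.
by rewrite odd_double mulnA mul2n mulnK // mulKn ?double_gt0.
Qed.

(** The comparison of [k] with the square root of [2 * n] is never an equality,
    so the dummy value is never taken. *)
Lemma factor_decompositionE k : odd_factor n k ->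
  ((k%:R : R) < Num.sqrt (2 * n%:R)
     /\ factor_decomposition R n k = small_factor_seq n k)
  \/ (Num.sqrt (2 * n%:R) < (k%:R : R)
     /\ factor_decomposition R n k = large_factor_seq n k).
Proof.
case/odd_factorP=> q [j [-> ->]].
rewrite /factor_decomposition lt_sqrtr_factor gt_sqrtr_factor.
by case: leqP; [right | left].
Qed.

Lemma factor_decompositionP k : odd_factor n k ->
  is_decomposition n (factor_decomposition R n k).
Proof.
move=> k_fac; case: (factor_decompositionE k_fac) => [[lt_k ->] | [gt_k ->]].
  by have [] := small_factor k_fac lt_k.
by have [] := large_factor k_fac gt_k.
Qed.

Lemma factor_decompositionK k : odd_factor n k ->
  factor_of n (factor_decomposition R n k) = k.
Proof.
move=> k_fac; have /andP[k_odd _] := k_fac; rewrite /factor_of.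
case: (factor_decompositionE k_fac) => [[lt_k ->] | [gt_k ->]].
  by have [_ ->] := small_factor k_fac lt_k; rewrite k_odd.
by have [_ /negbTE-> _ ->] := large_factor k_fac gt_k.
Qed.

Lemma factor_decomposition_onto s : is_decomposition n s ->
  exists2 k, odd_factor n k & s = factor_decomposition R n k.
Proof.
case/(decomposition_has_factor R) => k k_fac def_s; exists k => //.
rewrite /factor_decomposition; case: def_s => [[-> ->] // | [gt_k ->]].
by rewrite (lt_gtF gt_k) gt_k.
Qed.

Lemma factor_ofP s : is_decomposition n s -> odd_factor n (factor_of n s).
Proof.
by case/factor_decomposition_onto=> k k_fac ->; rewrite factor_decompositionK.
Qed.

Lemma factor_ofK s : is_decomposition n s ->
  factor_decomposition R n (factor_of n s) = s.
Proof.
by case/factor_decomposition_onto=> k k_fac ->; rewrite factor_decompositionK.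
Qed.

End Correspondence.

Theorem mainTheorem2 (R : rcfType) (n : nat) (n_gt0 : (0 < n)%N) :
  [/\ (forall k : nat, odd_factor n k -> (k%:R : R) < Num.sqrt (2 * n%:R) ->
         odd_decomposition n (small_factor_seq n k) /\ size (small_factor_seq n k) = k),
      (forall k : nat, odd_factor n k -> Num.sqrt (2 * n%:R) < (k%:R : R) ->
         even_decomposition n (large_factor_seq n k)
         /\ size (large_factor_seq n k) = (2 * n %/ k)%N),
      (forall s : seq int, is_decomposition n s ->
         exists2 k : nat, odd_factor n k &
           ((k%:R : R) < Num.sqrt (2 * n%:R) /\ s = small_factor_seq n k)
           \/ (Num.sqrt (2 * n%:R) < (k%:R : R) /\ s = large_factor_seq n k))
    & exists2 f : {k : nat | odd_factor n k} ->
                  {s : seq int | is_decomposition n s},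
        bijective f & forall k, val (f k) = factor_decomposition R n (val k)].
Proof.
split=> [k k_fac lt_k | k k_fac gt_k | s |].
- have [s_dec size_s] := small_factor k_fac lt_k.
  by rewrite /odd_decomposition s_dec size_s; case/andP: k_fac.
- have [s_dec s_even size_s _] := large_factor n_gt0 k_fac gt_k.
  by rewrite /even_decomposition s_dec s_even.
- exact: decomposition_has_factor.
(* The two maps are mutually inverse since [factor_of] is a left inverse of a
   surjection. *)
pose f (k : {k : nat | odd_factor n k}) : {s : seq int | is_decomposition n s} :=
  Sub (factor_decomposition R n (val k)) (factor_decompositionP R n_gt0 (valP k)).
pose g (s : {s : seq int | is_decomposition n s}) : {k : nat | odd_factor n k} :=
  Sub (factor_of n (val s)) (factor_ofP R n_gt0 (valP s)).
exists f => //; exists g => [k | s]; apply: val_inj.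
  exact: factor_decompositionK (valP k).
exact: factor_ofK (valP s).
Qed.
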